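(* Let $\mathbb{A},\mathbb{B},\mathbb{C},\mathbb{D}$ be algebraic structures and let $(\Gamma,\bar p,\mu_\Gamma)\colon\mathbb{A}\rightsquigarrow\mathbb{B}$, $(\Delta,\bar q,\mu_\Delta)\colon\mathbb{B}\rightsquigarrow\mathbb{C}$ and $(\Sigma,\bar r,\mu_\Sigma)\colon\mathbb{C}\rightsquigarrow\mathbb{D}$ be interpretations. Then the interpretations $$(\Gamma\circ(\Delta\circ\Sigma),(\bar{\bar p},(\bar{\bar q},\bar r)),\mu_\Gamma\circ(\mu_\Delta\circ\mu_\Sigma))\colon\mathbb{A}\rightsquigarrow\mathbb{D}$$ and $$((\Gamma\circ\Delta)\circ\Sigma,((\bar{\bar{\bar p}},\bar{\bar q}),\bar r),(\mu_\Gamma\circ\mu_\Delta)\circ\mu_\Sigma)\colon\mathbb{A}\rightsquigarrow\mathbb{D},$$ obtained by composing the given interpretations with the two possible placements of parentheses, are equal; moreover $\dim_{\mathrm{par}}\Gamma\circ(\Delta\circ\Sigma)=\dim_{\mathrm{par}}(\Gamma\circ\Delta)\circ\Sigma$.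
   Context: **Structures and codes.** $\mathbb{A}=\langle A;L(\mathbb{A})\rangle$ denotes a first-order structure with non-empty underlying set $A$ in the language $L(\mathbb{A})$ (logic with equality; constant, function and predicate symbols); similarly for other letters. Maps are applied to tuples coordinatewise. An interpretation code $\Gamma\colon L(\mathbb{A})\to L(\mathbb{B})$ is a family of $L(\mathbb{B})$-formulas $U_\Gamma(\bar x,\bar y)$, $E_\Gamma(\bar x,\bar x',\bar y)$, $c_\Gamma(\bar x,\bar y)$, $f_\Gamma(\bar x_0,\bar x_1,\ldots,\bar x_{n_f},\bar y)$, $R_\Gamma(\bar x_1,\ldots,\bar x_{n_R},\bar y)$, one for each constant symbol $c$, function symbol $f$, predicate symbol $R$ of $L(\mathbb{A})$, where all tuples $\bar x,\bar x',\bar x_i$ have the same length $\dim\Gamma$ and $|\bar y|=\dim_{\mathrm{par}}\Gamma$. For a tuple $\bar p$ from $B$ with $|\bar p|=\dim_{\mathrm{par}}\Gamma$ put $U_\Gamma(\mathbb{B},\bar p)=\{\bar b\mid\mathbb{B}\models U_\Gamma(\bar b,\bar p)\}$. The $L(\mathbb{A})$-structure $\Gamma(\mathbb{B},\bar p)$ is well-defined if $U_\Gamma(\mathbb{B},\bar p)\neq\emptyset$ and, on $U_\Gamma(\mathbb{B},\bar p)$, $E_\Gamma(\cdot,\cdot,\bar p)$ defines an equivalence relation $\sim_\Gamma$, each $c_\Gamma$ defines exactly one $\sim_\Gamma$-class, each $f_\Gamma$ defines (the preimage of) the graph $x_0=f(x_1,\ldots,x_{n_f})$ of an operation on $U_\Gamma(\mathbb{B},\bar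 p)/{\sim_\Gamma}$, and each $R_\Gamma$ defines (the preimage of) a relation on $U_\Gamma(\mathbb{B},\bar p)/{\sim_\Gamma}$; then $\Gamma(\mathbb{B},\bar p)$ is the resulting structure on $U_\Gamma(\mathbb{B},\bar p)/{\sim_\Gamma}$. An interpretation $(\Gamma,\bar p,\mu_\Gamma)\colon\mathbb{A}\rightsquigarrow\mathbb{B}$ consists of a code $\Gamma$, a tuple $\bar p$ such that $\Gamma(\mathbb{B},\bar p)$ is well-defined, and a surjection (coordinate map) $\mu_\Gamma\colon U_\Gamma(\mathbb{B},\bar p)\to A$ that induces an $L(\mathbb{A})$-isomorphism $\bar\mu_\Gamma\colon\Gamma(\mathbb{B},\bar p)\to\mathbb{A}$, $\bar\mu_\Gamma(\bar b/{\sim_\Gamma})=\mu_\Gamma(\bar b)$. **Translations.** A formula is in normal form if it is prenex and its matrix is a disjunction of conjunctions of unnested atomic formulas ($x=x'$, $x=c$, $f(x_1,\ldots,x_{n_f})=x_0$, $R(x_1,\ldots,x_{n_R})$) and their negations. For an $L(\mathbb{A})$-formula $\psi(x_1,\ldots,x_s)$ in normal form, $\psi_\Gamma(\bar x_1,\ldots,\bar x_s,\bar y)$ is the $L(\mathbb{B})$-formula obtained by replacing each variable by a tuple of $\dim\Gamma$ variables, replacing the unnested atomic formulas by $E_\Gamma,c_\Gamma,f_\Gamma,R_\Gamma$ respectively, relativizing all quantifiers to $U_\Gamma(\cdot,\bar y)$, and adding the conjuncts $U_\Gamma(\bar x_i,\bar y)$ for all listed free variables. A formula not in normal form is translated via a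 logically equivalent normal form. **Composition.** For codes $\Gamma\colon L(\mathbb{A})\to L(\mathbb{B})$ and $\Delta\colon L(\mathbb{B})\to L(\mathbb{C})$, the code $\Gamma\circ\Delta\colon L(\mathbb{A})\to L(\mathbb{C})$ consists of the $\Delta$-translations $(U_\Gamma)_\Delta,(E_\Gamma)_\Delta,(c_\Gamma)_\Delta,(f_\Gamma)_\Delta,(R_\Gamma)_\Delta$; $\dim\Gamma\circ\Delta=\dim\Gamma\cdot\dim\Delta$, and its parameter variables are the tuples replacing the parameter variables of $\Gamma$ followed by the parameter variables of $\Delta$, so that $\dim_{\mathrm{par}}\Gamma\circ\Delta=\dim_{\mathrm{par}}\Gamma\cdot\dim\Delta+\dim_{\mathrm{par}}\Delta$. The composition of interpretations $(\Gamma,\bar p,\mu_\Gamma)\colon\mathbb{A}\rightsquigarrow\mathbb{B}$ and $(\Delta,\bar q,\mu_\Delta)\colon\mathbb{B}\rightsquigarrow\mathbb{C}$ is the interpretation $(\Gamma\circ\Delta,(\bar{\bar p},\bar q),\mu_\Gamma\circ\mu_\Delta)\colon\mathbb{A}\rightsquigarrow\mathbb{C}$, where $\bar{\bar p}\in\mu_\Delta^{-1}(\bar p)$ (any choice). Thus in the claim $\bar{\bar q}$ is a preimage of $\bar q$ under $\mu_\Sigma$; in the first interpretation $\bar{\bar p}$ is a preimage of $\bar p$ under $\mu_\Delta\circ\mu_\Sigma$; and in the second $\bar{\bar{\bar p}}$ is a preimage under $\mu_\Sigma$ of a preimage of $\bar p$ under $\mu_\Delta$. **Equality.** Interpretations $(\Gamma_1,\bar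 p_1,\mu_{\Gamma_1}),(\Gamma_2,\bar p_2,\mu_{\Gamma_2})\colon\mathbb{A}\rightsquigarrow\mathbb{B}$ are called equal if $\Gamma_1(\mathbb{B},\bar p_1)=\Gamma_2(\mathbb{B},\bar p_2)$ (same underlying set of classes and same $L(\mathbb{A})$-structure) and $\mu_{\Gamma_1}=\mu_{\Gamma_2}$. *)

(* Defs.v *)
From Stdlib Require Eqdep.
From mathcomp Require Import all_boot.
From mathcomp Require Import boolp classical_sets.

Set Implicit Arguments.
Unset Strict Implicit.
Unset Printing Implicit Defensive.

Record language := Language {
  csym : Type;
  fsym : Type;
  far : fsym -> nat;
  rsym : Type;
  rar : rsym -> nat
}.

Record structure (L : language) := Structure {
  carrier :> Type;
  nonempty : inhabited carrier;
  cst : csym L -> carrier;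
  fn : forall f : fsym L, (far f).-tuple carrier -> carrier;
  rel : forall R : rsym L, (rar R).-tuple carrier -> Prop
}.

Record isomorphism (L : language) (M N : structure L) (h : M -> N) : Prop := {
  iso_bij : bijective h;
  iso_cst : forall c : csym L, h (cst M c) = cst N c;
  iso_fn : forall (f : fsym L) (xs : (far f).-tuple M),
    h (fn xs) = fn (map_tuple h xs);
  iso_rel : forall (R : rsym L) (xs : (rar R).-tuple M),
    rel xs <-> rel (map_tuple h xs)
}.

(* [term L n] and [formula L n]: the listed free variables are the elements of
   ['I_n]; a quantifier binds the variable [ord0] of its body and shifts the
   other ones by one. *)
Inductive term (L : language) (n : nat) : Type :=
| TVar of 'I_n
| TCst of csym L
| TFun (f : fsym L) of 'I_(far f) -> term L n.

Inductive formula (L : language) (n : nat) : Type :=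
| FEq of term L n & term L n
| FRel (R : rsym L) of 'I_(rar R) -> term L n
| FNot of formula L n
| FAnd of formula L n & formula L n
| FOr of formula L n & formula L n
| FImp of formula L n & formula L n
| FAll of formula L n.+1
| FEx of formula L n.+1.

Fixpoint eval (L : language) (M : structure L) n (v : n.-tuple M)
    (t : term L n) : M :=
  match t with
  | TVar i => tnth v i
  | TCst c => cst M c
  | TFun f ts => fn [tuple eval v (ts i) | i < far f]
  end.

Fixpoint sat (L : language) (M : structure L) n (phi : formula L n) :
    n.-tuple M -> Prop :=
  match phi with
  | FEq t u => fun v => eval v t = eval v u
  | FRel R ts => fun v => rel [tuple eval v (ts i) | i < rar R]
  | FNot a => fun v => ~ sat a v
  | FAnd a b => fun v => sat a v /\ sat b v
  | FOr a b => fun v => sat a v \/ sat b v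
  | FImp a b => fun v => sat a v -> sat b v
  | FAll a => fun v => forall x : M, sat a [tuple of x :: v]
  | FEx a => fun v => exists x : M, sat a [tuple of x :: v]
  end.

Definition logically_equivalent (L : language) n (phi psi : formula L n) :=
  forall (M : structure L) (v : n.-tuple M), sat phi v <-> sat psi v.

Definition up m n (s : 'I_m -> 'I_n) (i : 'I_m.+1) : 'I_n.+1 :=
  if unlift ord0 i is Some j then lift ord0 (s j) else ord0.

Fixpoint trename (L : language) m n (s : 'I_m -> 'I_n) (t : term L m) :
    term L n :=
  match t with
  | TVar i => TVar L (s i)
  | TCst c => TCst n c
  | TFun f ts => TFun (fun i => trename s (ts i))
  end.

Fixpoint rename (L : language) m n (s : 'I_m -> 'I_n) (phi : formula L m) :
    formula L n :=
  match phi with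
  | FEq t u => FEq (trename s t) (trename s u)
  | FRel R ts => FRel (fun i => trename s (ts i))
  | FNot a => FNot (rename s a)
  | FAnd a b => FAnd (rename s a) (rename s b)
  | FOr a b => FOr (rename s a) (rename s b)
  | FImp a b => FImp (rename s a) (rename s b)
  | FAll a => FAll (rename (up s) a)
  | FEx a => FEx (rename (up s) a)
  end.

(* The quantified block consists of the first [d] variables of the body. *)
Fixpoint all_block (L : language) n d : formula L (d + n) -> formula L n :=
  if d is d'.+1 then fun phi => all_block (FAll phi) else id.

Fixpoint ex_block (L : language) n d : formula L (d + n) -> formula L n :=
  if d is d'.+1 then fun phi => ex_block (FEx phi) else id.

Inductive uatom (L : language) (n : nat) : Type :=
| UVar of 'I_n & 'I_n
| UCst of 'I_n & csym L
| UFun (f : fsym L) of 'I_(far f) -> 'I_n & 'I_n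
| URel (R : rsym L) of 'I_(rar R) -> 'I_n.

Inductive literal (L : language) (n : nat) : Type :=
| LPos of uatom L n
| LNeg of uatom L n.

(* Conjunctions and disjunctions are non-empty and arbitrarily parenthesized. *)
Inductive clause (L : language) (n : nat) : Type :=
| CLit of literal L n
| CAnd of clause L n & clause L n.

Inductive dnf (L : language) (n : nat) : Type :=
| DClause of clause L n
| DOr of dnf L n & dnf L n.

Inductive nform (L : language) (n : nat) : Type :=
| NMatrix of dnf L n
| NAll of nform L n.+1
| NEx of nform L n.+1.

Definition formula_of_uatom (L : language) n (a : uatom L n) : formula L n :=
  match a with
  | UVar x x' => FEq (TVar L x) (TVar L x')
  | UCst x c => FEq (TVar L x) (TCst n c)
  | UFun f xs x0 => FEq (TFun (fun i => TVar L (xs i))) (TVar L x0)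
  | URel R xs => FRel (fun i => TVar L (xs i))
  end.

Definition formula_of_literal (L : language) n (l : literal L n) :
    formula L n :=
  match l with
  | LPos a => formula_of_uatom a
  | LNeg a => FNot (formula_of_uatom a)
  end.

Fixpoint formula_of_clause (L : language) n (c : clause L n) : formula L n :=
  match c with
  | CLit l => formula_of_literal l
  | CAnd c1 c2 => FAnd (formula_of_clause c1) (formula_of_clause c2)
  end.

Fixpoint formula_of_dnf (L : language) n (m : dnf L n) : formula L n :=
  match m with
  | DClause c => formula_of_clause c
  | DOr m1 m2 => FOr (formula_of_dnf m1) (formula_of_dnf m2)
  end.

Fixpoint formula_of_nform (L : language) n (psi : nform L n) : formula L n :=
  match psi with
  | NMatrix m => formula_of_dnf m
  | NAll a => FAll (formula_of_nform a)
  | NEx a => FEx (formula_of_nform a)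
  end.

(* A choice of a logically equivalent normal form for every formula, which does
   not touch the formulas that already are in normal form. Normal forms are far
   from unique, so compositions are parameterized by such a choice; there is one
   by [normalizer_exists]. *)
Record normalizer (L : language) := Normalizer {
  nf :> forall n, formula L n -> nform L n;
  nf_equiv : forall n (phi : formula L n),
    logically_equivalent (formula_of_nform (nf phi)) phi;
  nf_id : forall n (psi : nform L n), nf (formula_of_nform psi) = psi
}.

Lemma block_index_proof k d (i : 'I_k) (j : 'I_d) : i * d + j < k * d.
Proof.
apply: (@leq_trans (i * d + d)); first by rewrite ltn_add2l.
by rewrite -mulSnr leq_mul2r ltn_ord orbT.
Qed.

Definition block_index k d (i : 'I_k) (j : 'I_d) : 'I_(k * d) :=
  Ordinal (block_index_proof i j).

Lemma flat_proof k d (T : Type) (xs : k.-tuple (d.-tuple T)) :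
  size (flatten (map (@tval d T) xs)) == k * d.
Proof.
apply/eqP; case: xs => s /= /eqP <-.
by elim: s => //= x s IH; rewrite size_cat IH size_tuple mulSn.
Qed.

Definition flat k d (T : Type) (xs : k.-tuple (d.-tuple T)) :
  (k * d).-tuple T := Tuple (flat_proof xs).

Definition blocks k d (T : Type) (t : (k * d).-tuple T) :
    k.-tuple (d.-tuple T) :=
  [tuple [tuple tnth t (block_index i j) | j < d] | i < k].

Definition args k d e (T : Type) (xs : k.-tuple (d.-tuple T))
  (ys : e.-tuple T) : (k * d + e).-tuple T := cat_tuple (flat xs) ys.

(* A formula of type [formula L (k * d + e)] is a formula in [k] tuples of [d]
   variables followed by a tuple of [e] parameter variables. *)
Record code (LA LB : language) := Code {
  dim : nat;
  dim_par : nat;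
  cU : formula LB (1 * dim + dim_par);
  cE : formula LB (2 * dim + dim_par);
  cC : csym LA -> formula LB (1 * dim + dim_par);
  cF : forall f : fsym LA, formula LB ((far f).+1 * dim + dim_par);
  cR : forall R : rsym LA, formula LB (rar R * dim + dim_par)
}.

Section Translation.
Variables (LA LB : language) (G : code LA LB).
Let d := dim G.
Let e := dim_par G.

Definition xvar s (i : 'I_s) : d.-tuple 'I_(s * d + e) :=
  [tuple lshift e (block_index i j) | j < d].

Definition yvar s : e.-tuple 'I_(s * d + e) :=
  [tuple rshift (s * d) j | j < e].

(* [plug phi g] is phi(x_(g 0), ..., x_(g (k-1)), y). *)
Definition plug k s (phi : formula LB (k * d + e)) (g : k.-tuple 'I_s) :
    formula LB (s * d + e) :=
  rename (tnth (args (map_tuple (@xvar s) g) (yvar s))) phi.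

Definition tr_uatom s (a : uatom LA s) : formula LB (s * d + e) :=
  match a with
  | UVar x x' => plug (cE G) [tuple x; x']
  | UCst x c => plug (cC G c) [tuple x]
  | UFun f xs x0 => plug (cF G f) [tuple of x0 :: [tuple xs i | i < far f]]
  | URel R xs => plug (cR G R) [tuple xs i | i < rar R]
  end.

Definition tr_literal s (l : literal LA s) : formula LB (s * d + e) :=
  match l with
  | LPos a => tr_uatom a
  | LNeg a => FNot (tr_uatom a)
  end.

Fixpoint tr_clause s (c : clause LA s) : formula LB (s * d + e) :=
  match c with
  | CLit l => tr_literal l
  | CAnd c1 c2 => FAnd (tr_clause c1) (tr_clause c2)
  end.

Fixpoint tr_dnf s (m : dnf LA s) : formula LB (s * d + e) :=
  match m with
  | DClause c => tr_clause c
  | DOr m1 m2 => FOr (tr_dnf m1) (tr_dnf m2)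
  end.

Definition in_U s (i : 'I_s) : formula LB (s * d + e) := plug (cU G) [tuple i].

(* [s.+1 * d + e] is convertible to [d + s * d + e]. *)
Definition head_block s (phi : formula LB (s.+1 * d + e)) :
    formula LB (d + (s * d + e)) :=
  rename (cast_ord (esym (addnA d (s * d) e))) phi.

Fixpoint tr_nform s (psi : nform LA s) : formula LB (s * d + e) :=
  match psi with
  | NMatrix m => tr_dnf m
  | NAll a => all_block (head_block (FImp (in_U ord0) (tr_nform a)))
  | NEx a => ex_block (head_block (FAnd (in_U ord0) (tr_nform a)))
  end.

Definition translate (N : normalizer LA) s (phi : formula LA s) :
    formula LB (s * d + e) :=
  foldr (fun i chi => FAnd (in_U i) chi) (tr_nform (N s phi)) (enum 'I_s).

End Translation.

Lemma comp_dim k d1 e1 d2 e2 :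
  (k * d1 + e1) * d2 + e2 = k * (d1 * d2) + (e1 * d2 + e2).
Proof. by rewrite mulnDl mulnA addnA. Qed.

Definition comp_formula (LA LB LC : language) (N : normalizer LB)
    (G : code LA LB) (D : code LB LC) k
    (phi : formula LB (k * dim G + dim_par G)) :
    formula LC (k * (dim G * dim D) + (dim_par G * dim D + dim_par D)) :=
  rename (cast_ord (comp_dim _ _ _ _ _)) (translate D N phi).

Definition comp_code (LA LB LC : language) (N : normalizer LB)
    (G : code LA LB) (D : code LB LC) : code LA LC := {|
  dim := dim G * dim D;
  dim_par := dim_par G * dim D + dim_par D;
  cU := comp_formula N D (cU G);
  cE := comp_formula N D (cE G);
  cC := fun c => comp_formula N D (cC G c);
  cF := fun f => comp_formula N D (cF G f);
  cR := fun R => comp_formula N D (cR G R)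
|}.

Section InterpretedStructure.
Variables (LA LB : language) (G : code LA LB).
Variables (B : structure LB) (p : (dim_par G).-tuple B).

Definition holds k (phi : formula LB (k * dim G + dim_par G))
  (bs : k.-tuple ((dim G).-tuple B)) : Prop := sat phi (args bs p).

Definition udom (b : (dim G).-tuple B) : Prop := holds (cU G) [tuple b].

Definition equ (b b' : (dim G).-tuple B) : Prop := holds (cE G) [tuple b; b'].

(* Sets of tuples are represented as sets of sequences, so that the dimension
   does not occur in their type: tuples, classes and quotients of codes whose
   dimensions are equal but not convertible can be compared. *)
Definition defset (P : (dim G).-tuple B -> Prop) : set (seq B) :=
  fun s => exists2 b : (dim G).-tuple B, s = b & udom b /\ P b.

Definition eqclass (b : (dim G).-tuple B) : set (seq B) := defset (equ b).

Definition is_class (X : set (seq B)) : Prop :=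
  exists2 b : (dim G).-tuple B, udom b & X = eqclass b.

Definition quot : Type := {X : set (seq B) | is_class X}.

Definition class_of (b : (dim G).-tuple B) (Ub : udom b) : quot :=
  exist is_class (eqclass b) (ex_intro2 _ _ b Ub erefl).

Definition in_class (b : (dim G).-tuple B) (X : quot) : Prop := sval X b.

Record well_defined : Prop := WellDefined {
  wd_ex : exists b, udom b;
  wd_refl : forall b, udom b -> equ b b;
  wd_sym : forall b b', udom b -> udom b' -> equ b b' -> equ b' b;
  wd_trans : forall b b' b'', udom b -> udom b' -> udom b'' ->
    equ b b' -> equ b' b'' -> equ b b'';
  wd_cst : forall c, is_class (defset (fun b => holds (cC G c) [tuple b]));
  wd_fn : forall f, exists F : (far f).-tuple quot -> quot,
    forall b0 bs Xs, udom b0 -> (forall i, in_class (tnth bs i) (tnth Xs i)) ->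
    (holds (cF G f) [tuple of b0 :: bs] <-> in_class b0 (F Xs));
  wd_rel : forall R, exists P : (rar R).-tuple quot -> Prop,
    forall bs Xs, (forall i, in_class (tnth bs i) (tnth Xs i)) ->
    (holds (cR G R) bs <-> P Xs)
}.

Lemma quot_inhabited : well_defined -> inhabited quot.
Proof. by case=> -[b Ub] *; exact: (inhabits (class_of Ub)). Qed.

Definition quot_structure (W : well_defined) : structure LA := {|
  carrier := quot;
  nonempty := quot_inhabited W;
  cst := fun c => exist is_class _ (wd_cst W c);
  fn := fun f => sval (cid (wd_fn W f));
  rel := fun R => sval (cid (wd_rel W R))
|}.

End InterpretedStructure.

(* [imu] is a total function, but only its values on the tuples satisfying
   [udom ipar] are meaningful: no hypothesis and no conclusion constrains the
   other ones. *)
Record interp (LA LB : language) (A : structure LA) (B : structure LB) :=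
  Interp {
  icode :> code LA LB;
  ipar : (dim_par icode).-tuple B;
  imu : (dim icode).-tuple B -> A;
  imu_surj : forall a : A, exists2 b, udom ipar b & imu b = a;
  iwd : well_defined ipar;
  imu_iso : exists2 h : quot_structure iwd -> A, isomorphism h &
    forall b (Ub : udom ipar b), h (class_of Ub) = imu b
}.

Arguments imu {LA LB A B} i b : rename.

(* Both interpretations have the same set of classes, the same structure on it
   and the same coordinate map (as a function defined on [udom] only); their
   codes and parameters need not be equal. *)
Record interp_eq (LA LB : language) (A : structure LA) (B : structure LB)
    (I J : interp A B) : Prop := InterpEq {
  ieq_class : is_class (ipar I) = is_class (ipar J);
  ieq_cst : forall c, sval (cst (quot_structure (iwd I)) c) =
                      sval (cst (quot_structure (iwd J)) c);
  ieq_fn : forall f (Xs : (far f).-tuple (quot_structure (iwd I)))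
                    (Ys : (far f).-tuple (quot_structure (iwd J))),
    (forall i, sval (tnth Xs i) = sval (tnth Ys i)) ->
    sval (fn Xs) = sval (fn Ys);
  ieq_rel : forall R (Xs : (rar R).-tuple (quot_structure (iwd I)))
                     (Ys : (rar R).-tuple (quot_structure (iwd J))),
    (forall i, sval (tnth Xs i) = sval (tnth Ys i)) ->
    (rel Xs <-> rel Ys);
  ieq_dom : defset (ipar I) (fun=> True) = defset (ipar J) (fun=> True);
  ieq_mu : forall b b', udom (ipar I) b -> udom (ipar J) b' ->
    b = b' :> seq B -> imu I b = imu J b'
}.

(* The elementary form of "[mu] is a surjection that induces an isomorphism",
   see [interp_coordinate_map] and [interp_of_coordinate_map]; it serves to prove
   that compositions of interpretations are interpretations. *)
Record coordinate_map (LA LB : language) (A : structure LA) (B : structure LB)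
    (G : code LA LB) (p : (dim_par G).-tuple B)
    (mu : (dim G).-tuple B -> A) : Prop := CoordinateMap {
  cm_surj : forall a : A, exists2 b, udom p b & mu b = a;
  cm_eq : forall b b', udom p b -> udom p b' -> (equ p b b' <-> mu b = mu b');
  cm_cst : forall c b, udom p b ->
    (holds p (cC G c) [tuple b] <-> mu b = cst A c);
  cm_fn : forall f b0 bs, udom p b0 -> (forall i, udom p (tnth bs i)) ->
    (holds p (cF G f) [tuple of b0 :: bs] <-> mu b0 = fn (map_tuple mu bs));
  cm_rel : forall R bs, (forall i, udom p (tnth bs i)) ->
    (holds p (cR G R) bs <-> rel (map_tuple mu bs))
}.

Section CoordinateMap.
Variables (LA LB : language) (A : structure LA) (B : structure LB).

Lemma defset_tuple (G : code LA LB) (p : (dim_par G).-tuple B) P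
  (b : (dim G).-tuple B) : defset p P b <-> udom p b /\ P b.
Proof.
by split=> [[b' /val_inj ->] | H] //; exists b.
Qed.

Lemma eq_defset (G : code LA LB) (p : (dim_par G).-tuple B) P Q :
  (forall b, udom p b -> (P b <-> Q b)) -> defset p P = defset p Q.
Proof.
move=> PQ; apply/funext => s; apply/propext.
by split=> -[b -> [Ub Pb]]; exists b => //; split=> //; apply/PQ.
Qed.

Lemma interp_coordinate_map (I : interp A B) :
  coordinate_map (ipar I) (imu I).
Proof.
case: I => G p mu surj W [h hiso hmu] /=.
have classP b b' (Ub : udom p b) (Ub' : udom p b') :
  in_class b' (class_of Ub) <-> equ p b b'.
  by rewrite /in_class /= /eqclass defset_tuple; split=> [[]|].
have self b (Ub : udom p b) : in_class b (class_of Ub).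
  by apply/classP => //; apply: (wd_refl W).
have eqP b b' (Ub : udom p b) (Ub' : udom p b') : equ p b b' <-> mu b = mu b'.
  rewrite -(hmu b Ub) -(hmu b' Ub'); split=> [e|].
    congr h; apply: eq_exist; apply: eq_defset => c Uc; split=> H.
      by apply: (wd_trans W Ub' Ub Uc _ H); apply: (wd_sym W).
    exact: (wd_trans W Ub Ub' Uc e H).
  by move/(bij_inj (iso_bij hiso)) => e; apply/(classP b b' Ub Ub'); rewrite e.
have classI b (X : quot p) : in_class b X -> exists Ub, X = class_of (b := b) Ub.
  case: X => X cX; rewrite /in_class /=; have [c Uc EX] := cX.
  move=> bX; have [Ub e] : udom p b /\ equ p c b.
    by apply/defset_tuple; rewrite -/(eqclass p c) -EX.
  exists Ub; apply: eq_exist; rewrite EX; apply: eq_defset => a Ua.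
  by move: e; rewrite !eqP // => ->.
have mapI k (bs : k.-tuple ((dim G).-tuple B)) (Us : forall i, udom p (tnth bs i)) :
    let Xs := [tuple class_of (Us i) | i < k] in
    (forall i, in_class (tnth bs i) (tnth Xs i)) /\
    map_tuple h Xs = map_tuple mu bs.
  split=> [i|]; first by rewrite tnth_mktuple.
  by apply: eq_from_tnth => i; rewrite !tnth_map tnth_ord_tuple hmu.
split=> //.
- move=> c b Ub; have <- := iso_cst hiso c; rewrite -(hmu b Ub); split=> [e|].
    congr h; have [|Ub' ->] := classI b (cst (quot_structure W) c).
      by rewrite /in_class /= defset_tuple.
    by congr class_of; apply: Prop_irrelevance.
  move/(bij_inj (iso_bij hiso)) => e; have := self b Ub.
  by rewrite e /in_class /= defset_tuple => -[].
- move=> f b0 bs U0 Us; have [inX <-] := mapI _ bs Us.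
  rewrite -(iso_fn hiso) -(hmu b0 U0) /=.
  case: cid => F HF /=; rewrite (HF _ _ _ U0 inX); split=> [e|].
    by congr h; have [Ub' ->] := classI _ _ e; congr class_of; apply: Prop_irrelevance.
  by move/(bij_inj (iso_bij hiso)) <-.
- move=> R bs Us; have [inX <-] := mapI _ bs Us.
  rewrite -(iso_rel hiso) /=.
  by case: cid => P HP /=; apply: HP.
Qed.

Section OfCoordinateMap.
Variables (G : code LA LB) (p : (dim_par G).-tuple B).
Variables (mu : (dim G).-tuple B -> A) (cm : coordinate_map p mu).

Lemma fiber_is_class (a : A) : is_class p (defset p (fun b => mu b = a)).
Proof.
have [b Ub <-] := cm_surj cm a; exists b => //.
by apply: eq_defset => c Uc; rewrite (cm_eq cm) //; split=> ->.
Qed.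

Definition fiber (a : A) : quot p := exist _ _ (fiber_is_class a).

Lemma in_fiber b a : in_class b (fiber a) <-> udom p b /\ mu b = a.
Proof. exact: defset_tuple. Qed.

Lemma fiberE (X : quot p) : exists a, fiber a = X.
Proof.
case: X => X cX; have [b Ub EX] := cX.
exists (mu b); apply: eq_exist; rewrite EX; apply: eq_defset => c Uc.
by rewrite (cm_eq cm) //; split=> ->.
Qed.

Definition value (X : quot p) : A := sval (cid (fiberE X)).

Lemma valueK : cancel value fiber.
Proof. by move=> X; rewrite /value; case: cid. Qed.

Lemma fiberK : cancel fiber value.
Proof.
move=> a; have [b Ub mub] := cm_surj cm a.
have : in_class b (fiber a) by apply/in_fiber.
by rewrite -{1}[fiber a]valueK => /in_fiber [_ <-].
Qed.

Lemma in_classE b X : in_class b X <-> udom p b /\ mu b = value X.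
Proof. by rewrite -{1}[X]valueK; exact: in_fiber. Qed.

Lemma in_classesE k (bs : k.-tuple ((dim G).-tuple B)) (Xs : k.-tuple (quot p)) :
  (forall i, in_class (tnth bs i) (tnth Xs i)) ->
  (forall i, udom p (tnth bs i)) /\ map_tuple mu bs = map_tuple value Xs.
Proof.
move=> H; split=> [i|]; first by have /in_classE[] := H i.
by apply: eq_from_tnth => i; rewrite !tnth_map; have /in_classE[] := H i.
Qed.

Lemma coordinate_map_wd : well_defined p.
Proof.
split.
- case: (nonempty A) => a; have [b Ub _] := cm_surj cm a.
  by exists b.
- by move=> b Ub; apply/(cm_eq cm Ub Ub).
- by move=> b b' Ub Ub' /(cm_eq cm Ub Ub') e; apply/(cm_eq cm Ub' Ub).
- move=> b b' b'' Ub Ub' Ub'' /(cm_eq cm Ub Ub') e /(cm_eq cm Ub' Ub'') e'.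
  by apply/(cm_eq cm Ub Ub''); rewrite e.
- move=> c; rewrite (_ : defset _ _ = defset p (fun b => mu b = cst A c)).
    exact: fiber_is_class.
  by apply: eq_defset => b Ub; exact: (cm_cst cm).
- move=> f; exists (fun Xs => fiber (fn (map_tuple value Xs))).
  move=> b0 bs Xs U0 /in_classesE[Us E].
  by rewrite (cm_fn cm) // in_fiber E; split=> [|[]].
- move=> R; exists (fun Xs => rel (map_tuple value Xs)).
  by move=> bs Xs /in_classesE[Us E]; rewrite (cm_rel cm) // E.
Qed.

Lemma pick_classes k (Xs : k.-tuple (quot p)) :
  exists bs : k.-tuple ((dim G).-tuple B),
    forall i, in_class (tnth bs i) (tnth Xs i).
Proof.
have H (X : quot p) : exists b, in_class b X.
  have [b Ub E] := cm_surj cm (value X).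
  by exists b; apply/in_classE.
exists [tuple sval (cid (H (tnth Xs i))) | i < k] => i.
by rewrite tnth_mktuple; case: cid.
Qed.

Lemma value_isomorphism :
  isomorphism (M := quot_structure coordinate_map_wd) value.
Proof.
split.
- by exists fiber; [exact: valueK | exact: fiberK].
- move=> c; rewrite -[RHS]fiberK; congr value; apply: eq_exist.
  by apply: eq_defset => b Ub; exact: (cm_cst cm).
- move=> f Xs /=; case: cid => F /= HF.
  have [bs Hbs] := pick_classes Xs; have [Us E] := in_classesE Hbs.
  have [b Ub Eb] := cm_surj cm (value (F Xs)).
  rewrite -E -Eb; apply/(cm_fn cm Ub Us); apply/(HF _ _ _ Ub Hbs).
  by apply/in_classE.
- move=> R Xs /=; case: cid => P /= HP.
  have [bs Hbs] := pick_classes Xs; have [Us E] := in_classesE Hbs.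
  by rewrite -(HP _ _ Hbs) (cm_rel cm Us) E.
Qed.

Lemma value_class b (Ub : udom p b) : value (class_of Ub) = mu b.
Proof.
have : in_class b (class_of Ub).
  by apply/defset_tuple; split=> //; exact: (wd_refl coordinate_map_wd).
by move/in_classE => [].
Qed.

Definition interp_of_coordinate_map : interp A B :=
  Interp (cm_surj cm)
    (ex_intro2 _ _ (value : quot_structure coordinate_map_wd -> A)
       value_isomorphism value_class).

End OfCoordinateMap.
End CoordinateMap.

Lemma tnth_flat k d (T : Type) (xs : k.-tuple (d.-tuple T)) i j :
  tnth (flat xs) (block_index i j) = tnth (tnth xs i) j.
Proof.
pose x0 := tnth (tnth xs i) j; rewrite (tnth_nth x0) [RHS](tnth_nth x0) /=.
rewrite (tnth_nth (tnth xs i)); move: (tnth xs i) x0 => y0 x0.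
have : i < size xs by rewrite size_tuple.
elim: (val xs) (val i) => //= y s IH [|m] mk /=.
  by rewrite nth_cat size_tuple ltn_ord.
rewrite nth_cat size_tuple mulSn -addnA ltnNge leq_addr /= addKn.
exact: IH.
Qed.

Lemma block_indexP k d (m : 'I_(k * d)) :
  exists i : 'I_k, exists j : 'I_d, m = block_index i j.
Proof.
have d_gt0 : 0 < d by case: d m => // -[m]; rewrite muln0.
have ik : m %/ d < k by rewrite ltn_divLR.
have jd : m %% d < d by rewrite ltn_mod.
by exists (Ordinal ik), (Ordinal jd); apply/val_inj; rewrite /= -divn_eq.
Qed.

Lemma flat_blocks k d (T : Type) (t : (k * d).-tuple T) : flat (blocks t) = t.
Proof.
apply: eq_from_tnth => m; have [i [j ->]] := block_indexP m.
by rewrite tnth_flat !tnth_mktuple.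
Qed.

Lemma blocks_flat k d (T : Type) (t : k.-tuple (d.-tuple T)) :
  blocks (flat t) = t.
Proof.
apply: eq_from_tnth => i; apply: eq_from_tnth => j.
by rewrite !tnth_mktuple tnth_flat.
Qed.

Lemma map_flat k d (T S : Type) (g : T -> S) (xs : k.-tuple (d.-tuple T)) :
  map_tuple g (flat xs) = flat (map_tuple (map_tuple g) xs).
Proof.
apply: eq_from_tnth => m; have [i [j ->]] := block_indexP m.
by rewrite tnth_map !tnth_flat !tnth_map.
Qed.

Lemma map_cat_tuple m n (T S : Type) (g : T -> S) (xs : m.-tuple T)
  (ys : n.-tuple T) :
  map_tuple g (cat_tuple xs ys) = cat_tuple (map_tuple g xs) (map_tuple g ys).
Proof. by apply: val_inj; rewrite /= map_cat. Qed.

Lemma map_args k d e (T S : Type) (g : T -> S) (xs : k.-tuple (d.-tuple T))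
  (ys : e.-tuple T) :
  map_tuple g (args xs ys) = args (map_tuple (map_tuple g) xs) (map_tuple g ys).
Proof. by rewrite map_cat_tuple map_flat. Qed.

Section Semantics.
Variables (L : language) (M : structure L).

Lemma eval_trename m n (s : 'I_m -> 'I_n) (t : term L m) (v : n.-tuple M) :
  eval v (trename s t) = eval [tuple tnth v (s i) | i < m] t.
Proof.
elim: t => [i|c|f ts IH] //=; first by rewrite tnth_mktuple.
by congr fn; apply: eq_mktuple.
Qed.

Lemma up_tuple m n (s : 'I_m -> 'I_n) (v : n.-tuple M) (x : M) :
  [tuple tnth [tuple of x :: v] (up s i) | i < m.+1] =
  [tuple of x :: [tuple tnth v (s i) | i < m]].
Proof.
apply: eq_from_tnth => i; rewrite tnth_mktuple /up.
case: unliftP => [j|] ->; last by rewrite !tnth0.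
by rewrite !tnthS tnth_mktuple.
Qed.

Lemma sat_rename m n (s : 'I_m -> 'I_n) (phi : formula L m) (v : n.-tuple M) :
  sat (rename s phi) v <-> sat phi [tuple tnth v (s i) | i < m].
Proof.
elim: phi n s v => {m}
  [m t u|m R ts|m a IHa|m a IHa b IHb|m a IHa b IHb|m a IHa b IHb|m a IHa|m a IHa]
  n s v /=.
- by rewrite !eval_trename.
- by under [in X in X <-> _]eq_mktuple => i do rewrite eval_trename.
- by rewrite IHa.
- by rewrite IHa IHb.
- by rewrite IHa IHb.
- by rewrite IHa IHb.
- by split=> H x; have := H x; rewrite IHa up_tuple.
- by split=> -[x H]; exists x; move: H; rewrite IHa up_tuple.
Qed.

Lemma sat_rename_cast m n (E : m = n) (phi : formula L m) (v : n.-tuple M)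
    (w : m.-tuple M) :
  v = w :> seq M -> sat (rename (cast_ord E) phi) v <-> sat phi w.
Proof.
move=> vw; rewrite sat_rename; suff -> : [tuple tnth v (cast_ord E i) | i < m] = w by [].
case: _ / E v vw => v /val_inj ->.
by apply: eq_from_tnth => i; rewrite tnth_mktuple cast_ord_id.
Qed.

Lemma sat_ex_block n d (phi : formula L (d + n)) (v : n.-tuple M) :
  sat (ex_block phi) v <-> exists xs : d.-tuple M, sat phi (cat_tuple xs v).
Proof.
elim: d phi => [|d IH] phi /=.
  have E (t : 0.-tuple M) : cat_tuple t v = v.
    by apply: val_inj; rewrite /= (tuple0 t).
  by split=> [H|[t]]; [exists [tuple]|]; rewrite E.
rewrite IH /=; split=> [[xs [x H]]|[xs H]].
  exists [tuple of x :: xs]; suff -> : cat_tuple [tuple of x :: xs] v = [tuple of x :: cat_tuple xs v] by [].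
  exact: val_inj.
case/tupleP: xs H => x xs H; exists xs, x.
suff <- : cat_tuple [tuple of x :: xs] v = [tuple of x :: cat_tuple xs v] by [].
exact: val_inj.
Qed.

Lemma sat_all_block n d (phi : formula L (d + n)) (v : n.-tuple M) :
  sat (all_block phi) v <-> forall xs : d.-tuple M, sat phi (cat_tuple xs v).
Proof.
elim: d phi => [|d IH] phi /=.
  have E (t : 0.-tuple M) : cat_tuple t v = v.
    by apply: val_inj; rewrite /= (tuple0 t).
  by split=> [H t|/(_ [tuple])]; rewrite E.
rewrite IH /=; split=> [H xs|H xs x].
  case/tupleP: xs => x xs.
  suff -> : cat_tuple [tuple of x :: xs] v = [tuple of x :: cat_tuple xs v] by [].
  exact: val_inj.
suff <- : cat_tuple [tuple of x :: xs] v = [tuple of x :: cat_tuple xs v] by [].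
exact: val_inj.
Qed.

End Semantics.

Section TranslationSemantics.
Variables (LB LC : language) (B : structure LB) (C : structure LC).
Variable I : interp B C.
Let q := ipar I.

Lemma sat_plug k s (phi : formula LC (k * dim I + dim_par I)) (g : k.-tuple 'I_s)
    (cs : s.-tuple ((dim I).-tuple C)) :
  sat (plug phi g) (args cs q) <-> holds q phi (map_tuple (tnth cs) g).
Proof.
rewrite sat_rename /holds; set v := args cs q.
suff -> : [tuple tnth v (tnth (args (map_tuple (xvar I (s:=s)) g) (yvar I s)) i)
    | i < k * dim I + dim_par I] = args (map_tuple (tnth cs) g) q by [].
rewrite -[LHS]/(map_tuple _ _).
transitivity (map_tuple (tnth v) (args (map_tuple (xvar I (s:=s)) g) (yvar I s))).
  by apply: eq_from_tnth => i; rewrite tnth_mktuple tnth_map.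
rewrite map_args; congr args.
  apply: eq_from_tnth => i; apply: eq_from_tnth => j.
  by rewrite !tnth_map tnth_ord_tuple tnth_lshift tnth_flat.
by apply: eq_from_tnth => i; rewrite !tnth_map tnth_ord_tuple tnth_rshift.
Qed.

Let cm := interp_coordinate_map I.

Lemma sat_tr_uatom s (a : uatom LB s) (cs : s.-tuple ((dim I).-tuple C)) :
  (forall i, udom q (tnth cs i)) ->
  sat (tr_uatom I a) (args cs q) <->
  sat (formula_of_uatom a) (map_tuple (imu I) cs).
Proof.
move=> Us; case: a => [x x'|x c|f xs x0|R xs] /=; rewrite sat_plug.
- rewrite !tnth_map -(cm_eq cm) // /equ.
  by have -> : map_tuple (tnth cs) [tuple x; x'] = [tuple tnth cs x; tnth cs x'];
    first exact: val_inj.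
- rewrite tnth_map -(cm_cst cm) //.
  by have -> : map_tuple (tnth cs) [tuple x] = [tuple tnth cs x]; first exact: val_inj.
- set bs := map_tuple (tnth cs) [tuple xs i | i < far f].
  have -> : map_tuple (tnth cs) [tuple of x0 :: [tuple xs i | i < far f]] =
    [tuple of tnth cs x0 :: bs] by exact: val_inj.
  rewrite (cm_fn cm) // => [|i]; last by rewrite tnth_map.
  rewrite tnth_map.
  suff <- : map_tuple (imu I) bs =
     [tuple tnth (map_tuple (imu I) cs) (xs i) | i < far f] by split=> ->.
  by apply: eq_from_tnth => i; rewrite !tnth_map.
- rewrite (cm_rel cm) // => [|i]; last by rewrite tnth_map.
  suff <- : map_tuple (imu I) (map_tuple (tnth cs) [tuple xs i | i < rar R]) =
     [tuple tnth (map_tuple (imu I) cs) (xs i) | i < rar R] by [].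
  by apply: eq_from_tnth => i; rewrite !tnth_map.
Qed.

Lemma sat_in_U s (i : 'I_s) (cs : s.-tuple ((dim I).-tuple C)) :
  sat (in_U I i) (args cs q) <-> udom q (tnth cs i).
Proof.
rewrite sat_plug /udom.
by have -> : map_tuple (tnth cs) [tuple i] = [tuple tnth cs i]; first exact: val_inj.
Qed.

Lemma sat_head_block s (phi : formula LC (s.+1 * dim I + dim_par I)) c
    (cs : s.-tuple ((dim I).-tuple C)) :
  sat (head_block phi) (cat_tuple c (args cs q)) <->
  sat phi (args [tuple of c :: cs] q).
Proof. by apply: sat_rename_cast; rewrite /= catA. Qed.

Lemma sat_tr_nform s (psi : nform LB s) (cs : s.-tuple ((dim I).-tuple C)) :
  (forall i, udom q (tnth cs i)) ->
  sat (tr_nform I psi) (args cs q) <->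
  sat (formula_of_nform psi) (map_tuple (imu I) cs).
Proof.
have Scons k (ds : k.-tuple ((dim I).-tuple C)) c : udom q c ->
    (forall i, udom q (tnth ds i)) ->
    forall i, udom q (tnth [tuple of c :: ds] i).
  move=> Uc Uds i; case: (unliftP ord0 i) => [j|] ->; by rewrite ?tnthS ?tnth0.
have map_cons k (ds : k.-tuple ((dim I).-tuple C)) c :
    map_tuple (imu I) [tuple of c :: ds] =
    [tuple of imu I c :: map_tuple (imu I) ds] by apply: val_inj.
elim: psi cs => {s} [s m|s a IH|s a IH] cs Us /=.
- elim: m => [c|m1 IH1 m2 IH2] /=; last by rewrite IH1 IH2.
  elim: c => [l|c1 IH1 c2 IH2] /=; last by rewrite IH1 IH2.
  by case: l => a /=; rewrite sat_tr_uatom.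
- rewrite sat_all_block; split=> H.
    move=> b; have [c Uc <-] := cm_surj cm b.
    rewrite -map_cons -IH; last exact: Scons.
    by have /sat_head_block /= := H c; apply; apply/sat_in_U; rewrite tnth0.
  move=> c; apply/sat_head_block => /= /sat_in_U; rewrite tnth0 => Uc.
  by rewrite IH; [rewrite map_cons; exact: H | exact: Scons].
- rewrite sat_ex_block; split=> [[c /sat_head_block /= [/sat_in_U]]|[b]].
    rewrite tnth0 => Uc; rewrite IH; last exact: Scons.
    by rewrite map_cons; exists (imu I c).
  have [c Uc <-] := cm_surj cm b; rewrite -map_cons -IH; last exact: Scons.
  move=> H; exists c; apply/sat_head_block => /=; split=> //.
  by apply/sat_in_U; rewrite tnth0.
Qed.

Lemma sat_translate (N : normalizer LB) s (phi : formula LB s)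
    (cs : s.-tuple ((dim I).-tuple C)) :
  sat (translate I N phi) (args cs q) <->
  (forall i, udom q (tnth cs i)) /\ sat phi (map_tuple (imu I) cs).
Proof.
rewrite /translate.
have -> r chi : sat (foldr (fun i psi => FAnd (in_U I i) psi) chi r) (args cs q)
    <-> (forall i, i \in r -> udom q (tnth cs i)) /\ sat chi (args cs q).
  elim: r => [|i r IH] /=; first by split=> [|[]].
  rewrite IH sat_in_U; split=> [[Ui [Ur H]]|[Ur H]].
    by split=> // j; rewrite in_cons => /predU1P[->|/Ur].
  split; first by apply: Ur; rewrite mem_head.
  by split=> // j jr; apply: Ur; rewrite in_cons jr orbT.
split=> -[H1 H2].
  have U i : udom q (tnth cs i) by apply: H1; rewrite mem_enum.
  by split=> //; apply/(nf_equiv N); apply/sat_tr_nform.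
by split=> [i _|]; [exact: H1 | apply/sat_tr_nform => //; apply/(nf_equiv N)].
Qed.

End TranslationSemantics.

(* A preimage of a [k]-tuple under the coordinate map is kept as a [k]-tuple of
   [dim I]-tuples; [args] flattens it when it is used as a parameter. *)
Definition preimage (LB LC : language) (B : structure LB) (C : structure LC)
    (I : interp B C) k (bs : k.-tuple B) : Type :=
  {cs : k.-tuple ((dim I).-tuple C) |
    forall i, udom (ipar I) (tnth cs i) /\ imu I (tnth cs i) = tnth bs i}.

Lemma preimage_cat_proof (LB LC : language) (B : structure LB)
    (C : structure LC) (I : interp B C) k l (bs : k.-tuple B)
    (bs' : l.-tuple B) (cs : preimage I bs) (cs' : preimage I bs') i :
  udom (ipar I) (tnth (cat_tuple (sval cs) (sval cs')) i) /\
  imu I (tnth (cat_tuple (sval cs) (sval cs')) i) =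
    tnth (cat_tuple bs bs') i.
Proof.
case: cs cs' => cs Hcs [cs' Hcs'] /=.
case: (split_ordP i) => j ->; rewrite ?tnth_lshift ?tnth_rshift //.
Qed.

Definition preimage_cat (LB LC : language) (B : structure LB)
    (C : structure LC) (I : interp B C) k l (bs : k.-tuple B)
    (bs' : l.-tuple B) (cs : preimage I bs) (cs' : preimage I bs') :
    preimage I (cat_tuple bs bs') :=
  exist _ (cat_tuple (sval cs) (sval cs')) (preimage_cat_proof cs cs').

Section Composition.
Variables (LA LB LC : language).
Variables (A : structure LA) (B : structure LB) (C : structure LC).
Variables (N : normalizer LB) (I : interp A B) (J : interp B C).
Variable pp : preimage J (ipar I).

Let K := comp_code N I J.

Definition comp_par : (dim_par K).-tuple C := args (sval pp) (ipar J).

Definition comp_mu (c : (dim K).-tuple C) : A :=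
  imu I (map_tuple (imu J) (blocks c)).

Let nu (c : (dim K).-tuple C) : (dim I).-tuple B := map_tuple (imu J) (blocks c).

Let good (c : (dim K).-tuple C) := forall i, udom (ipar J) (tnth (blocks c) i).

Lemma holds_comp k (phi : formula LB (k * dim I + dim_par I))
    (cs : k.-tuple ((dim K).-tuple C)) :
  holds comp_par (G := K) (comp_formula N J phi) cs <->
  (forall i, good (tnth cs i)) /\ holds (ipar I) phi (map_tuple nu cs).
Proof.
pose ds := cat_tuple (flat (map_tuple (@blocks (dim I) (dim J) C) cs)) (sval pp).
have E : args cs comp_par = args ds (ipar J) :> seq C.
  rewrite /= map_cat flatten_cat -!catA; congr cat.
  have -> : flatten (map val cs) = flat cs by [].
  transitivity (val (flat (map_tuple (fun c => flat (blocks c)) cs))).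
    by congr (val (flat _)); apply: eq_from_tnth => i; rewrite tnth_map flat_blocks.
  rewrite /=; elim: (val cs) => //= c s ->.
  by rewrite map_cat flatten_cat.
rewrite /holds /comp_formula (sat_rename_cast _ _ E) sat_translate.
have -> : map_tuple (imu J) ds = args (map_tuple nu cs) (ipar I).
  rewrite map_cat_tuple map_flat; congr cat_tuple.
    by congr flat; apply: eq_from_tnth => i; rewrite !tnth_map.
  by apply: eq_from_tnth => i; rewrite tnth_map; case: (svalP pp i).
split=> -[H1 H2]; split=> // i.
  move=> j; have := H1 (lshift _ (block_index i j)).
  by rewrite tnth_lshift tnth_flat tnth_map.
case: (split_ordP i) => m ->; last first.
  by rewrite tnth_rshift; case: (svalP pp m).
have [a [b ->]] := block_indexP m; rewrite tnth_lshift tnth_flat tnth_map.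
exact: H1.
Qed.

Lemma udom_comp c :
  udom comp_par (G := K) c <-> good c /\ udom (ipar I) (nu c).
Proof.
rewrite /udom holds_comp.
have -> : map_tuple nu [tuple c] = [tuple nu c] by exact: val_inj.
by split=> -[H1 H2]; split=> // i; [exact: (H1 ord0) | rewrite ord1].
Qed.

Lemma comp_coordinate_map : coordinate_map comp_par (G := K) comp_mu.
Proof.
have cI := interp_coordinate_map I; have cJ := interp_coordinate_map J.
have goodU k (cs : k.-tuple ((dim K).-tuple C)) :
    (forall i, udom comp_par (G := K) (tnth cs i)) ->
    (forall i, good (tnth cs i)) /\ (forall i, udom (ipar I) (tnth (map_tuple nu cs) i)).
  by move=> H; split=> i; have /udom_comp[] := H i; rewrite ?tnth_map.
have map_mu k (cs : k.-tuple ((dim K).-tuple C)) :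
    map_tuple comp_mu cs = map_tuple (imu I) (map_tuple nu cs).
  by apply: eq_from_tnth => i; rewrite !tnth_map.
split.
- move=> a; have [b Ub <-] := cm_surj cI a.
  pose ds := [tuple s2val (cid2 (cm_surj cJ (tnth b i))) | i < dim I].
  have nuE : nu (flat ds) = b.
    rewrite /nu blocks_flat; apply: eq_from_tnth => i.
    by rewrite !tnth_map tnth_ord_tuple; case: cid2.
  exists (flat ds); last by rewrite /comp_mu -/(nu _) nuE.
  apply/udom_comp; rewrite nuE; split=> // i.
  by rewrite blocks_flat tnth_mktuple; case: cid2.
- move=> b b' /udom_comp[g U] /udom_comp[g' U'].
  rewrite /equ holds_comp /comp_mu -/(nu b) -/(nu b') -(cm_eq cI) //.
  have -> : map_tuple nu [tuple b; b'] = [tuple nu b; nu b'] by exact: val_inj.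
  split=> [[]|H] //; split=> // i.
  by case: (unliftP ord0 i) => [j|] ->; rewrite ?tnthS ?tnth0 // ord1.
- move=> c b /udom_comp[g U].
  rewrite holds_comp /comp_mu -/(nu b) -(cm_cst cI) //.
  have -> : map_tuple nu [tuple b] = [tuple nu b] by exact: val_inj.
  by split=> [[]|H] //; split=> // i; rewrite ord1.
- move=> f b0 bs /udom_comp[g U] /goodU[gs Us].
  rewrite holds_comp map_mu /comp_mu -/(nu b0) -(cm_fn cI) //.
  have -> : map_tuple nu [tuple of b0 :: bs] = [tuple of nu b0 :: map_tuple nu bs].
    exact: val_inj.
  split=> [[]|H] //; split=> // i.
  by case: (unliftP ord0 i) => [j|] ->; rewrite ?tnthS ?tnth0.
- move=> R bs /goodU[gs Us].
  by rewrite holds_comp map_mu -(cm_rel cI) //; split=> [[]|].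
Qed.

Definition interp_comp : interp A C :=
  @interp_of_coordinate_map LA LC A C (comp_code N I J) comp_par comp_mu
    comp_coordinate_map.

End Composition.

Arguments interp_comp {LA LB LC A B C} N I J pp.

Section NormalFormExists.
Variable L : language.

Definition definable n (P : forall M : structure L, n.-tuple M -> Prop) :=
  exists psi : nform L n, forall (M : structure L) (v : n.-tuple M),
    sat (formula_of_nform psi) v <-> P M v.

Lemma definable_ext n (P Q : forall M : structure L, n.-tuple M -> Prop) :
  (forall M v, P M v <-> Q M v) -> definable P -> definable Q.
Proof. by move=> PQ [psi H]; exists psi => M v; rewrite H. Qed.

Lemma definable_uatom n (a : uatom L n) :
  definable (fun M v => sat (formula_of_uatom a) v).
Proof. by exists (NMatrix (DClause (CLit (LPos a)))). Qed.

Lemma definable_ex n (P : forall M : structure L, n.+1.-tuple M -> Prop) :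
  definable P -> definable (fun M v => exists x : M, P M [tuple of x :: v]).
Proof.
case=> psi H; exists (NEx psi) => M v /=.
by split=> -[x] => [/H|/H]; exists x.
Qed.

Lemma definable_all n (P : forall M : structure L, n.+1.-tuple M -> Prop) :
  definable P -> definable (fun M v => forall x : M, P M [tuple of x :: v]).
Proof.
by case=> psi H; exists (NAll psi) => M v /=; split=> Hx x; apply/H.
Qed.

Let dnf_def n (P : forall M : structure L, n.-tuple M -> Prop) :=
  exists m : dnf L n, forall (M : structure L) (v : n.-tuple M),
    sat (formula_of_dnf m) v <-> P M v.

Lemma dnf_and n (m1 m2 : dnf L n) :
  dnf_def (fun M v => sat (formula_of_dnf m1) v /\ sat (formula_of_dnf m2) v).
Proof.
elim: m1 m2 => [c1|m IH m' IH'] m2; last first.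
  have [[x Hx] [y Hy]] := (IH m2, IH' m2); exists (DOr x y) => M v /=.
  by rewrite Hx Hy; tauto.
elim: m2 => [c2|m IH m' IH']; first by exists (DClause (CAnd c1 c2)).
case: IH IH' => [x Hx] [y Hy]; exists (DOr x y) => M v /=.
by rewrite Hx Hy /=; tauto.
Qed.

Lemma dnf_not n (m : dnf L n) :
  dnf_def (fun M v => ~ sat (formula_of_dnf m) v).
Proof.
elim: m => [c|m [x Hx] m' [y Hy]]; last first.
  have [z Hz] := dnf_and x y; exists z => M v /=.
  by rewrite Hz Hx Hy; tauto.
elim: c => [[a|a]|c [x Hx] c' [y Hy]] /=.
- by exists (DClause (CLit (LNeg a))).
- by exists (DClause (CLit (LPos a))) => M v /=; have := EM (sat (formula_of_uatom a) v); tauto.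
- exists (DOr x y) => M v /=; rewrite Hx Hy /=.
  by have := EM (sat (formula_of_clause c) v); tauto.
Qed.

Lemma definable_not n (P : forall M : structure L, n.-tuple M -> Prop) :
  definable P -> definable (fun M v => ~ P M v).
Proof.
case=> psi HP; suff [chi H] : definable (fun M v => ~ sat (formula_of_nform psi) v).
  by exists chi => M v; rewrite H HP.
elim: psi {P HP} => {n} [n m|n a [x Hx]|n a [x Hx]].
- by have [x Hx] := dnf_not m; exists (NMatrix x).
- by exists (NEx x) => M v /=; rewrite -existsNP; split=> -[y /Hx]; exists y.
- exists (NAll x) => M v /=; rewrite -forallNP.
  by split=> H y; apply/Hx.
Qed.

Definition urename m n (s : 'I_m -> 'I_n) (a : uatom L m) : uatom L n :=
  match a with
  | UVar x x' => UVar L (s x) (s x')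
  | UCst x c => UCst (s x) c
  | UFun f xs x0 => UFun (fun i => s (xs i)) (s x0)
  | URel R xs => URel (fun i => s (xs i))
  end.

Definition lrename m n (s : 'I_m -> 'I_n) (l : literal L m) : literal L n :=
  match l with
  | LPos a => LPos (urename s a)
  | LNeg a => LNeg (urename s a)
  end.

Fixpoint crename m n (s : 'I_m -> 'I_n) (c : clause L m) : clause L n :=
  match c with
  | CLit l => CLit (lrename s l)
  | CAnd c1 c2 => CAnd (crename s c1) (crename s c2)
  end.

Fixpoint drename m n (s : 'I_m -> 'I_n) (x : dnf L m) : dnf L n :=
  match x with
  | DClause c => DClause (crename s c)
  | DOr x1 x2 => DOr (drename s x1) (drename s x2)
  end.

Fixpoint nrename m n (s : 'I_m -> 'I_n) (psi : nform L m) : nform L n :=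
  match psi with
  | NMatrix x => NMatrix (drename s x)
  | NAll a => NAll (nrename (up s) a)
  | NEx a => NEx (nrename (up s) a)
  end.

Lemma formula_of_drename m n (s : 'I_m -> 'I_n) (x : dnf L m) :
  formula_of_dnf (drename s x) = rename s (formula_of_dnf x).
Proof.
elim: x => [c|x1 /= -> x2 ->] //=.
by elim: c => [[[]|[]]|c1 /= -> c2 ->].
Qed.

Lemma formula_of_nrename m n (s : 'I_m -> 'I_n) (psi : nform L m) :
  formula_of_nform (nrename s psi) = rename s (formula_of_nform psi).
Proof.
elim: psi n s => {m} [m x|m a IH|m a IH] n s /=; rewrite ?IH //.
exact: formula_of_drename.
Qed.

Lemma definable_rename m n (s : 'I_m -> 'I_n)
    (P : forall M : structure L, m.-tuple M -> Prop) :
  definable P -> definable (fun M v => P M [tuple tnth v (s i) | i < m]).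
Proof.
case=> psi HP; exists (nrename s psi) => M v.
by rewrite formula_of_nrename sat_rename.
Qed.

Lemma shift_tuple n (M : structure L) (x : M) (v : n.-tuple M) :
  [tuple tnth [tuple of x :: v] (lift ord0 i) | i < n] = v.
Proof. by apply: eq_from_tnth => i; rewrite tnth_mktuple tnthS. Qed.

Lemma definable_and n (P Q : forall M : structure L, n.-tuple M -> Prop) :
  definable P -> definable Q -> definable (fun M v => P M v /\ Q M v).
Proof.
case=> psi HP [chi HQ].
suff : definable (fun M v =>
    sat (formula_of_nform psi) v /\ sat (formula_of_nform chi) v).
  by apply: definable_ext => M v; rewrite HP HQ.
elim: psi chi {P Q HP HQ} => {n} [n m|n a IH|n a IH] chi.
- elim: chi m => {n} [n m'|n b IH|n b IH] m.
  + by have [x Hx] := dnf_and m m'; exists (NMatrix x).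
  + apply: definable_ext (definable_all (IH (drename (lift ord0) m))) => M v /=.
    rewrite formula_of_drename; split=> [H|[H1 H2] x]; last first.
      by rewrite sat_rename shift_tuple.
    split=> [|x]; last by have [] := H x.
    by case: (nonempty M) => x; have [] := H x; rewrite sat_rename shift_tuple.
  + apply: definable_ext (definable_ex (IH (drename (lift ord0) m))) => M v /=.
    rewrite formula_of_drename; split=> [[x]|[H1 [x H2]]].
      by rewrite sat_rename shift_tuple => -[H1 H2]; split=> //; exists x.
    by exists x; rewrite sat_rename shift_tuple.
- apply: definable_ext (definable_all (IH (nrename (lift ord0) chi))) => M v /=.
  rewrite formula_of_nrename; split=> [H|[H1 H2] x]; last first.
    by rewrite sat_rename shift_tuple.
  split=> [x|]; first by have [] := H x.
  by case: (nonempty M) => x; have [] := H x; rewrite sat_rename shift_tuple.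
- apply: definable_ext (definable_ex (IH (nrename (lift ord0) chi))) => M v /=.
  rewrite formula_of_nrename; split=> [[x]|[[x H1] H2]].
    by rewrite sat_rename shift_tuple => -[H1 H2]; split=> //; exists x.
  by exists x; rewrite sat_rename shift_tuple.
Qed.

Lemma definable_ex_block d n
    (P : forall M : structure L, (d + n).-tuple M -> Prop) :
  definable P ->
  definable (fun M v => exists xs : d.-tuple M, P M (cat_tuple xs v)).
Proof.
case=> psi HP.
suff [chi H] : exists chi : nform L n,
    formula_of_nform chi = ex_block (formula_of_nform psi).
  exists chi => M v; rewrite H sat_ex_block.
  by split=> -[xs] => [/HP|/HP]; exists xs.
by elim: d psi {P HP} => [|d IH] psi; [exists psi | exact: (IH (NEx psi))].
Qed.

Lemma definable_forall_ord k n
    (P : 'I_k -> forall M : structure L, n.-tuple M -> Prop) :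
  (forall i, definable (P i)) -> 0 < n ->
  definable (fun M v => forall i, P i M v).
Proof.
elim: k P => [|k IH] P HP n_gt0.
  apply: definable_ext (definable_uatom (UVar L (Ordinal n_gt0) (Ordinal n_gt0))).
  by move=> M v; split=> // _ [].
have H := definable_and (HP ord0) (IH _ (fun i => HP (lift ord0 i)) n_gt0).
apply: definable_ext H => M v; split=> [[H0 H] i|H]; last by split.
by case: (unliftP ord0 i) => [j|] ->.
Qed.

(* The graph of a term; the value is the first variable. *)
Lemma definable_term n (t : term L n) :
  definable (fun M (v : n.+1.-tuple M) =>
    eval [tuple tnth v (lift ord0 i) | i < n] t = tnth v ord0).
Proof.
elim: t => [i|c|f ts IH].
- apply: definable_ext (definable_uatom (UVar L (lift ord0 i) ord0)) => M v /=.
  by rewrite tnth_mktuple.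
- apply: definable_ext (definable_uatom (UCst ord0 c)) => M v /=.
  by split=> ->.
- have Hf := definable_uatom (UFun (lshift n.+1) (rshift (far f) (@ord0 n))).
  pose s i (j : 'I_n.+1) : 'I_(far f + n.+1) :=
    if unlift ord0 j is Some j' then rshift _ (lift ord0 j') else lshift _ i.
  have Hs i := definable_rename (s i) (IH i).
  have Hn : 0 < far f + n.+1 by rewrite addnS.
  apply: definable_ext (definable_ex_block
    (definable_and (definable_forall_ord Hs Hn) Hf)) => M v /=.
  have E (xs : (far f).-tuple M) i :
    [tuple tnth [tuple tnth (cat_tuple xs v) (s i i0) | i0 < n.+1] (lift ord0 i0)
      | i0 < n] = [tuple tnth v (lift ord0 i) | i < n].
    apply: eq_from_tnth => j.
    by rewrite !tnth_mktuple /s liftK tnth_rshift.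
  have E0 (xs : (far f).-tuple M) i :
    tnth [tuple tnth (cat_tuple xs v) (s i i0) | i0 < n.+1] ord0 = tnth xs i.
    by rewrite tnth_mktuple /s unlift_none tnth_lshift.
  split=> [[xs [H1]]|H].
    rewrite tnth_rshift => <-; congr fn; apply: eq_from_tnth => i.
    by have := H1 i; rewrite E E0 !tnth_mktuple tnth_lshift => ->.
  exists [tuple eval [tuple tnth v (lift ord0 i) | i < n] (ts i) | i < far f].
  split=> [i|]; first by rewrite E E0 tnth_mktuple.
  rewrite tnth_rshift -H; congr fn; apply: eq_from_tnth => i.
  by rewrite !tnth_mktuple tnth_lshift tnth_mktuple.
Qed.

Lemma definable_formula n (phi : formula L n) :
  definable (fun M v => sat phi v).
Proof.
elim: phi => {n} [n t u|n R ts|n a Ha|n a Ha b Hb|n a Ha b Hb|n a Ha b Hb|n a Ha|n a Ha].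
- apply: definable_ext (definable_ex
    (definable_and (definable_term t) (definable_term u))) => M v /=.
  rewrite [X in X <-> _](_ : _ = (exists x, eval v t = x /\ eval v u = x)).
    by split=> [[x [-> ->]]|->] //; exists (eval v u).
  by apply: eq_exists => x; rewrite shift_tuple tnth0.
- case: (posnP (rar R)) => [R0|R_gt0].
    have noi (i : 'I_(rar R)) : False by move: i; rewrite R0 => -[].
    apply: definable_ext (definable_uatom
      (URel (fun i : 'I_(rar R) => False_rect 'I_n (noi i)))) => M v /=.
    suff -> : [tuple tnth v (False_rect 'I_n (noi i)) | i < rar R] =
              [tuple eval v (ts i) | i < rar R] by [].
    by apply: eq_from_tnth => i; case: (noi i).
  pose s i (j : 'I_n.+1) : 'I_(rar R + n) :=
    if unlift ord0 j is Some j' then rshift _ j' else lshift _ i.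
  have Hs i := definable_rename (s i) (definable_term (ts i)).
  have Hn : 0 < rar R + n by rewrite addn_gt0 R_gt0.
  apply: definable_ext (definable_ex_block (definable_and
    (definable_forall_ord Hs Hn) (definable_uatom (URel (lshift n))))) => M v /=.
  have E (xs : (rar R).-tuple M) i :
    [tuple tnth [tuple tnth (cat_tuple xs v) (s i i0) | i0 < n.+1] (lift ord0 i0)
      | i0 < n] = v.
    apply: eq_from_tnth => j.
    by rewrite !tnth_mktuple /s liftK tnth_rshift.
  have E0 (xs : (rar R).-tuple M) i :
    tnth [tuple tnth (cat_tuple xs v) (s i i0) | i0 < n.+1] ord0 = tnth xs i.
    by rewrite tnth_mktuple /s unlift_none tnth_lshift.
  have El (xs : (rar R).-tuple M) :
    [tuple tnth (cat_tuple xs v) (lshift n i) | i < rar R] = xs.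
    by apply: eq_from_tnth => i; rewrite tnth_mktuple tnth_lshift.
  split=> [[xs []]|H].
    rewrite El => H1.
    suff -> : xs = [tuple eval v (ts i) | i < rar R] by [].
    by apply: eq_from_tnth => i; have := H1 i; rewrite E E0 tnth_mktuple => ->.
  exists [tuple eval v (ts i) | i < rar R]; rewrite El; split=> // i.
  by rewrite E E0 tnth_mktuple.
- exact: (definable_not Ha).
- exact: (definable_and Ha Hb).
- apply: definable_ext (definable_not
    (definable_and (definable_not Ha) (definable_not Hb))) => M v /=.
  by have := EM (sat a v); have := EM (sat b v); tauto.
- apply: definable_ext (definable_not
    (definable_and Ha (definable_not Hb))) => M v /=.
  by have := EM (sat b v); tauto.
- exact: (definable_all Ha).
- exact: (definable_ex Ha).
Qed.

End NormalFormExists.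

Lemma formula_of_nform_inj (L : language) n : injective (@formula_of_nform L n).
Proof.
have pairI := Eqdep.EqdepTheory.inj_pair2.
have uI k : injective (@formula_of_uatom L k).
  have funI m (xs ys : 'I_m -> 'I_k) :
      (fun i => TVar L (xs i)) = (fun i => TVar L (ys i)) -> xs = ys.
    by move=> e; apply/funext => i; have [] := congr1 (@^~ i) e.
  move=> [x x'|x c|f xs x0|R xs] [y y'|y c'|f' ys y0|R' ys] //=.
  - by case=> -> ->.
  - by case=> -> ->.
  - case=> ff'; move: ys; case: _ / ff' => ys e ->.
    by rewrite (funI _ _ _ (pairI _ _ _ _ _ e)).
  - case=> RR'; move: ys; case: _ / RR' => ys e.
    by rewrite (funI _ _ _ (pairI _ _ _ _ _ e)).
have lI k : injective (@formula_of_literal L k).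
  move=> [a|a] [b|b] /=; [by move/uI ->| by case: a | by case: b |].
  by case=> /uI ->.
have cI k : injective (@formula_of_clause L k).
  elim=> [l|c1 IH1 c2 IH2] [l'|d1 d2] /=.
  - by move/lI ->.
  - by case: l => -[].
  - by case: l' => -[].
  - by case=> /IH1 -> /IH2 ->.
have dI k : injective (@formula_of_dnf L k).
  elim=> [c|c1 IH1 c2 IH2] [c'|d1 d2] /=.
  - by move/cI ->.
  - by case: c => [[[]|]|].
  - by case: c' => [[[]|]|].
  - by case=> /IH1 -> /IH2 ->.
elim=> {n} [n m|n a IH|n a IH] [m'|b|b] //=.
- by move/dI ->.
- by case: m => [[[[]|]|]|].
- by case: m => [[[[]|]|]|].
- by case: m' => [[[[]|]|]|].
- by case=> /IH ->.
- by case: m' => [[[[]|]|]|].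
- by case=> /IH ->.
Qed.

Lemma normalizer_exists (L : language) : inhabited (normalizer L).
Proof.
have H n (phi : formula L n) : exists psi : nform L n,
    logically_equivalent (formula_of_nform psi) phi /\
    forall chi, formula_of_nform chi = phi -> psi = chi.
  have [[chi <-]|H] := EM (exists chi, formula_of_nform chi = phi).
    by exists chi; split=> // chi' /formula_of_nform_inj.
  have [psi Hpsi] := definable_formula phi; exists psi; split=> // chi E.
  by case: H; exists chi.
constructor.
apply: (Normalizer (nf := fun n phi => sval (cid (H n phi)))) => [n phi|n psi].
  by case: cid => psi [].
by case: cid => chi /= [_]; apply.
Qed.

(* Main.v *)
From mathcomp Require Import boolp.
Require Import Defs.
From mathcomp Require Import all_boot.

Set Implicit Arguments.
Unset Strict Implicit.
Unset Printing Implicit Defensive.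

(** An interpretation is determined, up to equality, by the graph of its
    coordinate map: the classes are the fibers of the map and the structure on
    them is pulled back from the interpreted structure along the induced
    isomorphism. So two interpretations with the same graph are equal
    ([interp_eq_of_mu_graph]), whatever their codes, parameters and normal forms.

    The graph of a composition is a relational composition: a word [s] over [C]
    represents [a] iff [s] is a concatenation of words that represent, letter by
    letter, a word over [B] that represents [a] ([mu_graph_comp]). Extending a
    relation from letters to words by concatenation commutes with this
    composition ([wordwise_comp]), and this gives the associativity. *)

(** On words instead of tuples, because the dimensions (k * d) * d' and
    k * (d * d') are not convertible: the concatenations for the two placements
    of parentheses then have the same type. *)
Inductive wordwise (T S : Type) (R : seq T -> S -> Prop) :
    seq T -> seq S -> Prop :=
| wordwise_nil : wordwise R [::] [::]
| wordwise_cons t x ts xs :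
    R t x -> wordwise R ts xs -> wordwise R (t ++ ts) (x :: xs).

Section Wordwise.
Variables (T S : Type) (R : seq T -> S -> Prop).

Lemma wordwise_cat ts xs us ys :
  wordwise R ts xs -> wordwise R us ys -> wordwise R (ts ++ us) (xs ++ ys).
Proof.
move=> Rts Rus; elim: Rts => [|t x {}ts {}xs Rt _ IH] //=.
by rewrite -catA; exact: wordwise_cons.
Qed.

Lemma wordwise_consP ts x xs : wordwise R ts (x :: xs) ->
  exists t us, [/\ ts = t ++ us, R t x & wordwise R us xs].
Proof. by move=> Rts; inversion Rts as [|t ? us]; exists t, us. Qed.

Lemma wordwise_catP ts xs ys : wordwise R ts (xs ++ ys) ->
  exists us vs, [/\ ts = us ++ vs, wordwise R us xs & wordwise R vs ys].
Proof.
elim: xs ts => [|x xs IH] ts /=.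
  by exists [::], ts; split=> //; exact: wordwise_nil.
case/wordwise_consP => t [_ [-> Rt /IH[us [vs [-> Rus Rvs]]]]].
by exists (t ++ us), vs; rewrite catA; split=> //; exact: wordwise_cons.
Qed.

(** A word related to a concatenation splits accordingly, so the intermediate
    word can be chosen letter by letter or all at once. *)
Lemma wordwise_comp (V : Type) (Q : seq S -> V -> Prop) ts zs :
  wordwise (fun t z => exists2 x, wordwise R t x & Q x z) ts zs <->
  exists2 xs, wordwise R ts xs & wordwise Q xs zs.
Proof.
split=> [|[xs + Qxs]].
  elim=> [|t z {}ts {}zs [x Rt Qx] _ [xs Rts Qxs]].
    by exists [::]; exact: wordwise_nil.
  by exists (x ++ xs); [exact: wordwise_cat | exact: wordwise_cons].
elim: Qxs ts => [|x z {}xs {}zs Qx _ IH] ts.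
  by move=> Rts; inversion Rts; exact: wordwise_nil.
case/wordwise_catP => us [vs [-> Rus /IH Rvs]].
by apply: wordwise_cons => //; exists x.
Qed.

End Wordwise.

Section MuGraph.
Variables (LA LB : language) (A : structure LA) (B : structure LB).

Definition mu_graph (I : interp A B) (s : seq B) (a : A) : Prop :=
  exists b : (dim I).-tuple B, [/\ s = b, udom (ipar I) b & imu I b = a].

Lemma mu_graph_fun (I : interp A B) s a a' :
  mu_graph I s a -> mu_graph I s a' -> a = a'.
Proof. by case=> b [-> _ <-] [b' [/val_inj <- _ <-]]. Qed.

Lemma mu_graph_surj (I : interp A B) a : exists s, mu_graph I s a.
Proof.
by have [b Ub <-] := imu_surj I a; exists b, b.
Qed.

Lemma eqclass_mu_graph (I : interp A B) b : udom (ipar I) b ->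
  eqclass (ipar I) b = (fun s => mu_graph I s (imu I b)).
Proof.
move=> Ub; apply/funext => s; apply/propext.
have eqE := cm_eq (interp_coordinate_map I).
by split=> [[c -> [Uc /(eqE _ _ Ub Uc) ->]]|[c [-> Uc /esym/(eqE _ _ Ub Uc)]]];
  exists c.
Qed.

Lemma is_class_mu_graph (I : interp A B) X :
  is_class (ipar I) X <-> exists a, X = (fun s => mu_graph I s a).
Proof.
split=> [[b Ub ->]|[a ->]]; first by exists (imu I b); exact: eqclass_mu_graph.
have [b Ub <-] := imu_surj I a.
by exists b => //; rewrite eqclass_mu_graph.
Qed.

(** Gives access to the constants, operations and relations on the classes
    through those of [A], with no recourse to the formulas of the code. *)
Lemma imu_iso_fiber (I : interp A B) :
  exists2 h : quot_structure (iwd I) -> A, isomorphism h &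
    forall X : quot_structure (iwd I), sval X = (fun s => mu_graph I s (h X)).
Proof.
have [h hiso hmu] := imu_iso I; exists h => // -[X cX].
have [b Ub EX] := cX.
rewrite (_ : exist _ X cX = class_of Ub); last exact: eq_exist.
by rewrite hmu -eqclass_mu_graph.
Qed.

(** Classes with the same elements are fibers over the same element, because
    fibers are non-empty and disjoint. Hence they correspond under the two
    induced isomorphisms, and both structures are pulled back from [A]. *)
Lemma interp_eq_of_mu_graph (I J : interp A B) :
  (forall s a, mu_graph I s a <-> mu_graph J s a) -> interp_eq I J.
Proof.
move=> IJ.
have fiberE a : (fun s => mu_graph I s a) = (fun s => mu_graph J s a).
  by apply/funext => s; exact/propext.
have [h hiso hE] := imu_iso_fiber I; have [g giso gE] := imu_iso_fiber J.
have hg X Y : sval X = sval Y -> h X = g Y.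
  have [s sX] := mu_graph_surj I (h X).
  rewrite hE gE => /(congr1 (@^~ s)) /= e.
  by apply: (mu_graph_fun sX); apply/IJ; rewrite -e.
have hgs k (Xs : k.-tuple (quot_structure (iwd I)))
    (Ys : k.-tuple (quot_structure (iwd J))) :
    (forall i, sval (tnth Xs i) = sval (tnth Ys i)) ->
    map_tuple h Xs = map_tuple g Ys.
  by move=> XY; apply: eq_from_tnth => i; rewrite !tnth_map; exact: hg.
split.
- apply/funext => X; apply/propext; rewrite !is_class_mu_graph.
  by split=> -[a ->]; exists a; rewrite fiberE.
- by move=> c; rewrite hE gE (iso_cst hiso) (iso_cst giso).
- by move=> f Xs Ys /hgs XY; rewrite hE gE (iso_fn hiso) (iso_fn giso) XY.
- by move=> R Xs Ys /hgs XY; rewrite (iso_rel hiso) (iso_rel giso) XY.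
- apply/funext => s; apply/propext; split=> -[b -> [Ub _]].
    have /IJ[c [-> Uc _]] : mu_graph I b (imu I b) by exists b.
    by exists c.
  have /IJ[c [-> Uc _]] : mu_graph J b (imu J b) by exists b.
  by exists c.
- move=> b b' Ub Ub' bb'; apply: (@mu_graph_fun I b); first by exists b.
  by apply/IJ; exists b'.
Qed.

(** All letters are represented by words of length [dim I], so the factors of a
    concatenation are recovered by cutting it into blocks. *)
Lemma wordwise_mu_graph (I : interp A B) k s (xs : k.-tuple A) :
  wordwise (mu_graph I) s xs <->
  exists bs : k.-tuple ((dim I).-tuple B),
    [/\ s = flat bs, forall i, udom (ipar I) (tnth bs i) &
        map_tuple (imu I) bs = xs].
Proof.
elim: k s xs => [|k IH] s xs.
  rewrite (tuple0 xs); split=> [Is|[bs [-> _ _]]].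
    by exists [tuple]; split=> [|[]|] //; [inversion Is | exact: val_inj].
  by rewrite /= (tuple0 bs); exact: wordwise_nil.
case/tupleP: xs => x xs; split.
  move=> /= Isx; have [t [us [-> [b [-> Ub <-]] Ius]]] := wordwise_consP Isx.
  have /IH[bs [-> Ubs <-]] := Ius.
  exists [tuple of b :: bs]; split=> // [i|]; last exact: val_inj.
  by case: (unliftP ord0 i) => [j|] ->; rewrite ?tnthS ?tnth0.
case=> bs [-> Ubs <-]; case/tupleP: bs Ubs => b bs Ubs.
apply: wordwise_cons.
  by exists b; split=> //; have := Ubs ord0; rewrite tnth0.
apply/(IH _ (map_tuple (imu I) bs)); exists bs; split=> // i.
by have := Ubs (lift ord0 i); rewrite tnthS.
Qed.

End MuGraph.

(** By the semantics of the translation, the composed code defines the tuples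
    whose blocks represent the letters of a tuple in the domain of [I], and a
    tuple is the concatenation of its blocks. *)
Lemma mu_graph_comp (LA LB LC : language)
    (A : structure LA) (B : structure LB) (C : structure LC)
    (N : normalizer LB) (I : interp A B) (J : interp B C)
    (pp : preimage J (ipar I)) s a :
  mu_graph (interp_comp N I J pp) s a <->
  exists2 t, wordwise (mu_graph J) s t & mu_graph I t a.
Proof.
split=> [[c [-> /udom_comp[Jc Ic] <-]]|[t Jt [b [tb Ub <-]]]].
  pose b := map_tuple (imu J) (blocks c); exists b; last by exists b.
  apply/wordwise_mu_graph; exists (blocks c); split=> //.
  exact: (esym (congr1 val (flat_blocks c))).
move: Jt; rewrite tb => /wordwise_mu_graph[cs [-> Ucs csb]].
exists (flat cs); split=> //; last by rewrite /= /comp_mu blocks_flat csb.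
by apply/udom_comp; rewrite blocks_flat csb.
Qed.

Theorem proposition9
  (LA LB LC LD : language)
  (A : structure LA) (B : structure LB) (C : structure LC) (D : structure LD)
  (NB NB' : normalizer LB) (NC NC' : normalizer LC)
  (Gamma : interp A B) (Delta : interp B C) (Sigma : interp C D)
  (q2 : preimage Sigma (ipar Delta))
  (p2 : preimage (interp_comp NC Delta Sigma q2) (ipar Gamma))
  (p1 : preimage Delta (ipar Gamma))
  (p3 : preimage Sigma (flat (sval p1))) :
  interp_eq
    (interp_comp NB Gamma (interp_comp NC Delta Sigma q2) p2)
    (interp_comp NC' (interp_comp NB' Gamma Delta p1) Sigma (preimage_cat p3 q2)) /\
  dim_par (comp_code NB Gamma (comp_code NC Delta Sigma)) =
  dim_par (comp_code NC' (comp_code NB' Gamma Delta) Sigma).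
Proof.
split; last exact: (esym (comp_dim _ _ _ _ _)).
apply: interp_eq_of_mu_graph => s a; rewrite !mu_graph_comp.
have -> : mu_graph (interp_comp NC Delta Sigma q2) =
    (fun t z => exists2 x, wordwise (mu_graph Sigma) t x & mu_graph Delta x z).
  by apply/funext => t; apply/funext => z; apply/propext; exact: mu_graph_comp.
split=> [[t /wordwise_comp[u Su Du] Gt]|[u Su /mu_graph_comp[t Du Gt]]].
  by exists u => //; apply/mu_graph_comp; exists t.
by exists t => //; apply/wordwise_comp; exists u.
Qed.
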